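(* Let $n$ be a positive integer, let $m,t$ be positive divisors of $n$ with $n\nmid mt$, let $\zeta\in\Bbbk$ be a primitive $n$-th root of unity, and put $q=\zeta^{mt}$, $N=\operatorname{ord}(q)$. Let $y,x$ denote the generators of $H_n(\zeta,m,t)$ and $Y,X$ the corresponding generators of $H_n(\zeta,t,m)$. Then the bilinear form on $H_n(\zeta,t,m)\times H_n(\zeta,m,t)$ defined on bases by $$\langle X^iY^j,\,x^ky^\ell\rangle=\delta_{i,k}\,(i)_q!\,\zeta^{j\ell}\qquad(0\le i,k<N,\ 0\le j,\ell<n)$$ is a perfect duality.
   Context: $\Bbbk$ is an algebraically closed field of characteristic $0$. $(k)_q=1+q+\dots+q^{k-1}$, $(i)_q!=(1)_q(2)_q\cdots(i)_q$, $(0)_q!=1$. $H_n(\zeta,m,t)$ is the Hopf algebra generated as a $\Bbbk$-algebra by $y,x$ subject to $y^n=1$, $x^N=0$ (with $N=\operatorname{ord}(\zeta^{mt})$), $yx=\zeta^txy$, with $\Delta(y)=y\otimes y$, $\Delta(x)=y^m\otimes x+x\otimes1$, $\epsilon(y)=1$, $\epsilon(x)=0$, $S(y)=y^{-1}$, $S(x)=-y^{-m}x$. It has basis $\{x^ky^\ell\}_{0\le k<N,\,0\le\ell<n}$. Thus $H_n(\zeta,t,m)$ is generated by $Y,X$ with $Y^n=1$, $X^N=0$, $YX=\zeta^mXY$, $Y$ grouplike, $\Delta(X)=Y^t\otimes X+X\otimes1$. A bilinear form $\langle\ ,\ \rangle$ on $H\times K$, for Hopf algebras $H,K$, is a duality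 if for all $u,v\in H$ and $z,w\in K$: $\langle uv,z\rangle=\langle u,z_{(1)}\rangle\langle v,z_{(2)}\rangle$, $\langle u,zw\rangle=\langle u_{(1)},z\rangle\langle u_{(2)},w\rangle$, $\langle1,z\rangle=\epsilon_K(z)$, $\langle u,1\rangle=\epsilon_H(u)$, $\langle S_H(u),z\rangle=\langle u,S_K(z)\rangle$. The duality is perfect if the induced maps $H\to K^*$ and $K\to H^*$ are injective. *)

(* Defs.v *)
From HB Require Import structures.
From mathcomp Require Import all_boot all_order all_algebra all_field.
From mathcomp Require Import sesquilinear.
Set Implicit Arguments.
Unset Strict Implicit.
Unset Printing Implicit Defensive.
Import GRing.Theory VectorInternalTheory.
Local Open Scope ring_scope.

(* U (x) V for finite-dimensional U and V: the matrices indexed by the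
   canonical bases of U and V.  The algebra structure put on it below is the
   tensor product one, not the matrix product.  [tlift f] is the linear map U (x) V -> W
   induced by a bilinear f (tliftE below), so that
   [tlift (fun a b => E a b) (comul h)] reads as E(h_(1), h_(2)) in Sweedler
   notation. *)
Section Tensor.
Variable k : fieldType.

Definition tensor (U V : vectType k) : Type := 'M[k]_(dim U, dim V).

HB.instance Definition _ (U V : vectType k) :=
  Vector.copy (tensor U V) 'M[k]_(dim U, dim V).

Definition tens (U V : vectType k) (u : U) (v : V) : tensor U V :=
  (v2r u)^T *m v2r v.

Definition cbase (U : vectType k) (i : 'I_(dim U)) : U := r2v (delta_mx 0 i).

Definition tlift (U V : vectType k) (W : lmodType k) (f : U -> V -> W)
    (z : tensor U V) : W :=
  \sum_i \sum_j (z : 'M[k]_(dim U, dim V)) i j *: f (cbase i) (cbase j).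

End Tensor.

Notation "u \ox v" := (tens u v) (at level 40, left associativity) : ring_scope.

Section TensorTheory.
Variables (k : fieldType) (U V : vectType k).

Lemma tens_bilinear :
  bilinear_for *:%R *:%R (@tens k U V : U -> V -> tensor U V).
Proof.
split=> [v a u u' | u a v v']; rewrite /tens linearP /=.
  by rewrite linearP /= mulmxDl -scalemxAl.
by rewrite mulmxDr -scalemxAr.
Qed.

HB.instance Definition _ := bilinear_isBilinear.Build k U V (tensor U V)
  *:%R *:%R (@tens k U V) tens_bilinear.

Lemma tlift_linear (W : lmodType k) (f : U -> V -> W) : linear (tlift f).
Proof.
move=> a z w; rewrite /tlift scaler_sumr -big_split; apply: eq_bigr => i _ /=.
rewrite scaler_sumr -big_split; apply: eq_bigr => j _ /=.
by rewrite !mxE scalerDl scalerA.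
Qed.

HB.instance Definition _ (W : lmodType k) (f : U -> V -> W) :=
  GRing.isLinear.Build k (tensor U V) W *:%R (tlift f) (tlift_linear f).

Lemma cbase_sum (X : vectType k) (u : X) : u = \sum_i v2r u 0 i *: cbase i.
Proof.
apply: v2r_inj; rewrite linear_sum [LHS]row_sum_delta; apply: eq_bigr => i _.
by rewrite linearZ /= r2vK.
Qed.

Lemma tliftE (W : lmodType k) (f : U -> V -> W) :
  bilinear_for *:%R *:%R f -> forall u v, tlift f (u \ox v) = f u v.
Proof.
move=> f_bil u v; pose g : {bilinear U -> V -> W} := HB.pack f
  (bilinear_isBilinear.Build k U V W *:%R *:%R f f_bil).
rewrite -[f]/(g : U -> V -> W) [in RHS](cbase_sum u) linear_sumlz.
apply: eq_bigr => i _; rewrite linearZl_LR [in RHS](cbase_sum v) linear_sumr.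
rewrite scaler_sumr; apply: eq_bigr => j _.
by rewrite linearZr_LR scalerA mxE big_ord1 mxE.
Qed.

Lemma eq_tlift (W : lmodType k) (f g : U -> V -> W) z :
  (forall u v, f u v = g u v) -> tlift f z = tlift g z.
Proof.
by move=> fg; apply: eq_bigr => i _; apply: eq_bigr => j _; rewrite fg.
Qed.

Lemma tliftP (W : lmodType k) (f g : U -> V -> W) a z :
  tlift (fun u v => a *: f u v + g u v) z = a *: tlift f z + tlift g z.
Proof.
rewrite /tlift scaler_sumr -big_split; apply: eq_bigr => i _ /=.
rewrite scaler_sumr -big_split; apply: eq_bigr => j _ /=.
by rewrite scalerDr !scalerA mulrC.
Qed.

Lemma tens_sum (z : tensor U V) :
  z = \sum_i \sum_j
        (z : 'M[k]_(dim U, dim V)) i j *: (cbase i \ox cbase j : tensor U V).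
Proof.
rewrite [LHS](matrix_sum_delta (z : 'M[k]_(dim U, dim V))).
apply: eq_bigr => i _; apply: eq_bigr => j _; congr (_ *: _).
by rewrite /tens !r2vK trmx_delta mul_delta_mx.
Qed.

Lemma tens_ext (W : lmodType k) (f g : tensor U V -> W) :
  linear f -> linear g -> (forall u v, f (u \ox v) = g (u \ox v)) -> f =1 g.
Proof.
move=> fl gl fg z.
pose F : {linear tensor U V -> W} := HB.pack f (GRing.isLinear.Build _ _ _ _ f fl).
pose G : {linear tensor U V -> W} := HB.pack g (GRing.isLinear.Build _ _ _ _ g gl).
rewrite -[f z]/(F z) -[g z]/(G z) [z]tens_sum !linear_sum; apply: eq_bigr => i _.
rewrite !linear_sum; apply: eq_bigr => j _.
by rewrite !linearZ /= fg.
Qed.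

End TensorTheory.

Section TensorAlgebra.
Variables (k : fieldType) (A B : falgType k).
Implicit Types z w : tensor A B.

Definition tmul z w : tensor A B :=
  tlift (fun a b => tlift (fun c d => (a * c) \ox (b * d)) w) z.

Definition tone : tensor A B := 1 \ox 1.

Lemma tmulPl w : linear (tmul^~ w).
Proof. exact: tlift_linear. Qed.

Lemma tmulPr z : linear (tmul z).
Proof.
by move=> a w w'; rewrite /tmul -tliftP; apply: eq_tlift => u v; rewrite linearP.
Qed.

Lemma tmulE a b c d :
  tmul (a \ox b) (c \ox d) = (a * c) \ox (b * d) :> tensor A B.
Proof.
rewrite /tmul tliftE; first rewrite tliftE //.
  by split=> [v|u] e x y /=; rewrite mulrDr -scalerAr ?linearPl ?linearPr.
split=> [v|u] e x y /=; rewrite -tliftP; apply: eq_tlift => c' d';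
  by rewrite mulrDl -scalerAl ?linearPl ?linearPr.
Qed.

Lemma tmulA : associative tmul.
Proof.
move=> z w v; move: z; apply: tens_ext => [||a b].
- by move=> e x y; rewrite tmulPl.
- by move=> e x y; rewrite !tmulPl.
move: w; apply: tens_ext => [||c d].
- by move=> e x y; rewrite tmulPl tmulPr.
- by move=> e x y; rewrite tmulPr tmulPl.
move: v; apply: tens_ext => [||a' b'].
- by move=> e x y; rewrite !tmulPr.
- by move=> e x y; rewrite tmulPr.
by rewrite !tmulE !mulrA.
Qed.

Lemma tmul1l : left_id tone tmul.
Proof.
apply: tens_ext => [e x y|e x y|a b] //; first by rewrite tmulPr.
by rewrite tmulE !mul1r.
Qed.

Lemma tmul1r : right_id tone tmul.
Proof.
apply: tens_ext => [e x y|e x y|a b] //; first by rewrite tmulPl.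
by rewrite tmulE !mulr1.
Qed.

Lemma tmulDl : left_distributive tmul +%R.
Proof. by move=> x y z; have:= tmulPl z 1 x y; rewrite !scale1r. Qed.

Lemma tmulDr : right_distributive tmul +%R.
Proof. by move=> z x y; have:= tmulPr z 1 x y; rewrite !scale1r. Qed.

Lemma tone_neq0 : tone != 0.
Proof.
have nz (C : falgType k) : exists i, v2r (1 : C) 0 i != 0.
  apply/existsP; rewrite -negb_forall; apply/negP => /forallP v0.
  have /eqP[] := oner_neq0 C; apply: v2r_inj; apply/rowP => i.
  by rewrite linear0 mxE; apply/eqP.
have [[i i0] [j j0]] := (nz A, nz B).
apply/eqP => /matrixP/(_ i j)/eqP; rewrite !mxE big_ord1 mxE.
by rewrite mulf_eq0 (negPf i0) (negPf j0).
Qed.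

HB.instance Definition _ := GRing.Zmodule_isNzRing.Build (tensor A B)
  tmulA tmul1l tmul1r tmulDl tmulDr tone_neq0.

Lemma tscaleAl a z w : a *: (z * w) = (a *: z) * w.
Proof.
have:= tmulPl w a z 0; have -> : tmul 0 w = 0 by exact: mul0r w.
by rewrite !addr0.
Qed.

Lemma tscaleAr a z w : a *: (z * w) = z * (a *: w).
Proof.
have:= tmulPr z a w 0; have -> : tmul z 0 = 0 by exact: mulr0 z.
by rewrite !addr0.
Qed.

HB.instance Definition _ :=
  GRing.Lmodule_isLalgebra.Build k (tensor A B) tscaleAl.
HB.instance Definition _ :=
  GRing.Lalgebra_isAlgebra.Build k (tensor A B) tscaleAr.
HB.instance Definition _ := Algebra_isFalgebra.Build k (tensor A B).

End TensorAlgebra.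

HB.mixin Record isHopf (k : fieldType) H of Falgebra k H := {
  comul : {lrmorphism H -> tensor H H};
  counit : {lrmorphism H -> k^o};
  antipode : {linear H -> H};
  comulA : forall h,
    tlift (fun a b => tlift (fun a1 a2 => a1 \ox (a2 \ox b)) (comul a)) (comul h)
    = tlift (fun a b => a \ox comul b) (comul h);
  counitl : forall h, tlift (fun a b => counit a *: b) (comul h) = h;
  counitr : forall h, tlift (fun a b => counit b *: a) (comul h) = h;
  antipodel : forall h,
    tlift (fun a b => antipode a * b) (comul h) = counit h *: 1;
  antipoder : forall h,
    tlift (fun a b => a * antipode b) (comul h) = counit h *: 1;
}.

#[short(type="hopfAlgType")]
HB.structure Definition HopfAlgebra (k : fieldType) :=
  { H of isHopf k H & Falgebra k H }.

Record duality (k : fieldType) (H K : hopfAlgType k)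
    (B : {bilinear H -> K -> k^o}) : Prop := Duality {
  dual_mull : forall u v z,
    B (u * v) z = tlift (fun z1 z2 => B u z1 * B v z2) (comul z);
  dual_mulr : forall u z w,
    B u (z * w) = tlift (fun u1 u2 => B u1 z * B u2 w) (comul u);
  dual_1l : forall z, B 1 z = counit z;
  dual_1r : forall u, B u 1 = counit u;
  dual_antipode : forall u z, B (antipode u) z = B u (antipode z);
}.

Record perfect_duality (k : fieldType) (H K : hopfAlgType k)
    (B : {bilinear H -> K -> k^o}) : Prop := PerfectDuality {
  perfect_dual :> duality B;
  perfect_injl : forall u v, B u =1 B v -> u = v;
  perfect_injr : forall z w, B^~ z =1 B^~ w -> z = w;
}.

Definition qint (R : nzRingType) (q : R) (i : nat) : R := \sum_(j < i) q ^+ j.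

Definition qfact (R : nzRingType) (q : R) (i : nat) : R :=
  \prod_(1 <= j < i.+1) qint q j.

Definition Hn_rel (k : fieldType) (n N : nat) (zeta : k) (t : nat)
    (A : algType k) (y x : A) : Prop :=
  [/\ y ^+ n = 1, x ^+ N = 0 & y * x = zeta ^+ t *: (x * y)].

(* H, with the generators y and x, is H_n(zeta, m, t): as an algebra it is
   generated by y and x subject exactly to Hn_rel, i.e. any pair satisfying
   Hn_rel in an algebra A is the image of (y, x) under an algebra morphism. *)
Record is_Hn (k : fieldType) (n N : nat) (zeta : k) (m t : nat)
    (H : hopfAlgType k) (y x : H) : Prop := IsHn {
  Hn_ord : N.-primitive_root (zeta ^+ (m * t));
  Hn_gen : <<1 & [:: y; x]>>%VS = fullv;
  Hn_relP : Hn_rel n N zeta t y x;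
  Hn_univ : forall (A : algType k) (b a : A), Hn_rel n N zeta t b a ->
    exists f : {lrmorphism H -> A}, f y = b /\ f x = a;
  Hn_comul_y : comul y = y \ox y;
  Hn_comul_x : comul x = (y ^+ m) \ox x + x \ox 1;
  Hn_counit_y : counit y = 1;
  Hn_counit_x : counit x = 0;
  Hn_antipode_y : antipode y = y^-1;
  Hn_antipode_x : antipode x = - (y ^- m * x);
}.

(* Main.v *)
(* The functionals b, a on K = H_n(zeta, m, t) given by b(x^k y^l) = [k = 0] zeta^l
   and a(x^k y^l) = [k = 1] come from algebra maps: b is a character, and a
   is the off-diagonal entry of the representation y |-> diag(zeta^t, 1),
   x |-> E12.  Multiplication by b and a in the convolution algebra K^* scales
   monomials, resp. lowers the x-degree with a factor (k)_q, which gives the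
   values of all a^i b^j and shows that b, a satisfy the relations of
   H = H_n(zeta, t, m).  Hence H -> K^*, Y |-> b, X |-> a is an algebra map, i.e.
   a form multiplicative in H.  The same construction with the roles of H and K
   exchanged gives a form multiplicative in K with the same values on monomials,
   so the two forms coincide.  Compatibility with the antipodes is uniqueness of
   convolution inverses, and nondegeneracy follows since a polynomial of degree
   < n cannot vanish at all n-th roots of unity. *)
From HB Require Import structures.
Require Import Defs.
From mathcomp Require Import all_boot all_order all_algebra all_field.
From mathcomp Require Import sesquilinear.
Set Implicit Arguments.
Unset Strict Implicit.
Unset Printing Implicit Defensive.
Import GRing.Theory.
Local Open Scope ring_scope.

Lemma tlift_comp (k : fieldType) (U V : vectType k) (W W' : lmodType k)
    (g : {linear W -> W'}) (f : U -> V -> W) z :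
  g (tlift f z) = tlift (fun u v => g (f u v)) z.
Proof.
rewrite /tlift linear_sum; apply: eq_bigr => i _.
by rewrite linear_sum; apply: eq_bigr => j _; rewrite linearZ.
Qed.

(** * Convolution of linear maps out of a Hopf algebra *)

Section Convolution.
Variables (k : fieldType) (H : hopfAlgType k) (A : algType k).
Implicit Types F G L : {linear H -> A}.

(** The target is an arbitrary algebra because two cases occur: [k] itself, for the product of the
    dual, and [hdual K], for the comparison of antipodes. *)
Definition conv F G (u : H) : A := tlift (fun a b => F a * G b) (comul u).

Lemma conv_linear F G : linear (conv F G).
Proof. by move=> c u v; rewrite /conv !linearP. Qed.

HB.instance Definition _ F G :=
  GRing.isLinear.Build k H A *:%R (conv F G) (conv_linear F G).

Lemma convE F G u : conv F G u = tlift (fun a b => F a * G b) (comul u).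
Proof. by []. Qed.

(** This is coassociativity, pushed forward along the linear map [tlift T] with a (x) (b (x) c) |->
    F a (G b L c). *)
Lemma convA F G L : conv F (conv G L) =1 conv (conv F G) L.
Proof.
move=> u; pose r a b := fun c => F a * (G b * L c).
pose T (a : H) (w : tensor H H) : A := tlift (fun b c => F a * (G b * L c)) w.
have Tbil : bilinear_for *:%R *:%R T.
  split=> [w|a] c p p'; last by rewrite /T linearP.
  rewrite /T -tliftP; apply: eq_tlift => b d.
  by rewrite linearP mulrDl -scalerAl.
have TE a b c : T a (b \ox c) = F a * (G b * L c).
  rewrite /T tliftE //; split=> [v|v] d p p' /=;
    by rewrite linearP ?(mulrDl, mulrDr, =^~scalerAl, =^~scalerAr).
have := congr1 (tlift T) (comulA u); rewrite !(tlift_comp (tlift T)) /= => eT.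
transitivity (tlift (fun a b => tlift T (a \ox comul b)) (comul u)).
  apply: eq_tlift => a b; rewrite tliftE // /T /= convE.
  exact: (tlift_comp (GRing.mull_fun (F a) idfun)).
rewrite -eT; apply: eq_tlift => a b; rewrite (tlift_comp (tlift T)).
rewrite /= convE [RHS](tlift_comp (GRing.mulr_fun (L b) idfun)).
by apply: eq_tlift => a1 a2; rewrite /= tliftE // TE mulrA.
Qed.

End Convolution.

(** * The dual of a Hopf algebra as an algebra under convolution *)

Section DualAlgebra.
Variables (k : fieldType) (K : hopfAlgType k).

(** A separate name for the space of functionals, to carry the convolution product. *)
Definition hdual : Type := 'Hom(K, k^o).

HB.instance Definition _ := Vector.copy hdual 'Hom(K, k^o).

(* Evaluation is not a coercion: elaborating [(f + g) z] would then look for the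
   sum in 'Hom(K, k^o) instead of hdual. *)
Definition dapp (f : hdual) : K -> k^o := fun_of_lfun f.

HB.instance Definition _ (f : hdual) :=
  GRing.Linear.copy (dapp f) (fun_of_lfun f).

Definition functional (f : {linear K -> k^o}) : hdual := linfun f.

Lemma functionalE f : dapp (functional f) =1 f. Proof. exact: lfunE. Qed.

Lemma dapp_inj (f g : hdual) : dapp f =1 dapp g -> f = g.
Proof. by move/lfunP. Qed.

Lemma dappPl z : linear (dapp^~ z).
Proof. by move=> a f g; rewrite /= /dapp add_lfunE scale_lfunE. Qed.

(** The image of [z] in the bidual. *)
Definition deval z (f : hdual) := dapp f z.

HB.instance Definition _ z := GRing.isLinear.Build k hdual k^o *:%R
  (deval z) (dappPl z).

Definition dmul (f g : hdual) : hdual := functional (conv (dapp f) (dapp g)).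
Definition dual_one : hdual := functional counit.

Lemma dmulE f g z :
  dapp (dmul f g) z = tlift (fun a b => dapp f a * dapp g b : k^o) (comul z).
Proof. exact: functionalE. Qed.

Lemma dmulA : associative dmul.
Proof.
move=> f g h; apply/dapp_inj => z; rewrite !dmulE.
transitivity (conv (dapp f) (conv (dapp g) (dapp h)) z).
  by apply: eq_tlift => a b; rewrite functionalE.
by rewrite convA; apply: eq_tlift => a b; rewrite functionalE.
Qed.

Lemma dmul1l : left_id dual_one dmul.
Proof.
move=> f; apply/dapp_inj => z; rewrite dmulE -[z in RHS]counitl tlift_comp.
by apply: eq_tlift => a b; rewrite functionalE linearZ.
Qed.

Lemma dmul1r : right_id dual_one dmul.
Proof.
move=> f; apply/dapp_inj => z; rewrite dmulE -[z in RHS]counitr tlift_comp.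
by apply: eq_tlift => a b; rewrite functionalE linearZ /= mulrC.
Qed.

Lemma dmulPl g : linear (dmul^~ g).
Proof.
move=> a f f'; apply/dapp_inj => z /=; rewrite dappPl !dmulE -tliftP.
by apply: eq_tlift => u v; rewrite dappPl mulrDl -scalerAl.
Qed.

Lemma dmulPr g : linear (dmul g).
Proof.
move=> a f f'; apply/dapp_inj => z /=; rewrite dappPl !dmulE -tliftP.
by apply: eq_tlift => u v; rewrite dappPl mulrDr -scalerAr.
Qed.

Lemma dmulDl : left_distributive dmul +%R.
Proof. by move=> x y z; have:= dmulPl z 1 x y; rewrite !scale1r. Qed.

Lemma dmulDr : right_distributive dmul +%R.
Proof. by move=> z x y; have:= dmulPr z 1 x y; rewrite !scale1r. Qed.

Lemma dual_one_neq0 : dual_one != 0.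
Proof.
apply/eqP => /(congr1 (deval 1))/eqP.
by rewrite linear0 /deval functionalE rmorph1 oner_eq0.
Qed.

HB.instance Definition _ := GRing.Zmodule_isNzRing.Build hdual
  dmulA dmul1l dmul1r dmulDl dmulDr dual_one_neq0.

Lemma dscaleAl a (f g : hdual) : a *: (f * g) = (a *: f) * g.
Proof.
have:= dmulPl g a f 0; have -> : dmul 0 g = 0 by exact: mul0r g.
by rewrite !addr0.
Qed.

Lemma dscaleAr a (f g : hdual) : a *: (f * g) = f * (a *: g).
Proof.
have:= dmulPr f a g 0; have -> : dmul f 0 = 0 by exact: mulr0 f.
by rewrite !addr0.
Qed.

HB.instance Definition _ := GRing.Lmodule_isLalgebra.Build k hdual dscaleAl.
HB.instance Definition _ := GRing.Lalgebra_isAlgebra.Build k hdual dscaleAr.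

Lemma dapp_mul (f g : hdual) z :
  dapp (f * g) z = tlift (fun a b => dapp f a * dapp g b : k^o) (comul z).
Proof. exact: dmulE. Qed.

Lemma dapp_one z : dapp 1 z = counit z.
Proof. exact: functionalE. Qed.

Lemma dappZ a f z : dapp (a *: f) z = a * dapp f z.
Proof. by rewrite -[LHS]/(deval z _) linearZ. Qed.

Lemma dapp0 z : dapp 0 z = 0.
Proof. by rewrite -[LHS]/(deval z _) linear0. Qed.

End DualAlgebra.

(** * Spanning by monomials and nondegeneracy *)

Section Monomials.
Variables (k : fieldType) (A : falgType k) (n N t : nat) (zeta : k) (y x : A).
Hypotheses (n_gt0 : (0 < n)%N) (gen : <<1 & [:: y; x]>>%VS = fullv).
Hypothesis rel : Hn_rel n N zeta t y x.

Lemma rel_yx i : y * x ^+ i = zeta ^+ (t * i) *: (x ^+ i * y).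
Proof.
have [_ _ yx] := rel; elim: i => [|i IH].
  by rewrite muln0 !expr0 mulr1 mul1r scale1r.
rewrite exprSr mulrA IH -scalerAl -[x ^+ i * y * x]mulrA yx -scalerAr scalerA mulrA.
by rewrite -exprD mulnS addnC.
Qed.

(** The span of the monomials contains 1 and is stable under left multiplication by [y] and [x], so
    it contains the algebra they generate. *)
Lemma Hn_span z :
  exists c : 'I_N -> 'I_n -> k, z = \sum_i \sum_j c i j *: (x ^+ i * y ^+ j).
Proof.
have [yn xN _] := rel.
pose I := ('I_N * 'I_n)%type.
pose E := [tuple x ^+ (enum_val i).1 * y ^+ (enum_val i).2 | i < #|{: I}|].
have EE (i : 'I_#|{: I}|) : E`_i = x ^+ (enum_val i).1 * y ^+ (enum_val i).2.
  by rewrite -tnth_nth tnth_mktuple.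
(* Arbitrary exponents are allowed: [x ^+ i] vanishes from [N] on, and exponents of [y] reduce mod
   [n]. Stability then needs no boundary cases. *)
have inE i j : x ^+ i * y ^+ j \in <<E>>%VS.
  have [i_lt|/subnK <-] := ltnP i N; last first.
    by rewrite exprD xN mulr0 mul0r mem0v.
  rewrite -(expr_mod j yn); apply: memv_span; apply/tnthP.
  exists (enum_rank (Ordinal i_lt, Ordinal (ltn_pmod j n_gt0))).
  by rewrite tnth_mktuple enum_rankK.
have stable a : (forall i : 'I_#|{: I}|, a * E`_i \in <<E>>%VS) ->
    (<[a]> * <<E>> <= <<E>>)%VS.
  move=> aE; apply/prodvP => _ v /vlineP[b ->] /coord_span ->.
  rewrite mulr_sumr rpred_sum // => i _.
  by rewrite -scalerAl -scalerAr !rpredZ.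
have zE : z \in <<E>>%VS.
  suff: (fullv <= <<E>>)%VS by move/subvP; apply; rewrite memvf.
  rewrite -gen; apply: agenv_sub_modl.
    by rewrite -memvE; have := inE 0 0; rewrite !expr0 mulr1.
  rewrite prodvDl prod1v span_cons span_seq1 prodvDl !subv_add subvv /=.
  apply/andP; split; apply: stable => i; rewrite EE mulrA.
    by rewrite rel_yx -scalerAl -mulrA -exprS rpredZ.
  by rewrite -exprS.
exists (fun i j => coord E (enum_rank (i, j)) z); rewrite pair_bigA /=.
rewrite {1}(coord_span zE) (reindex enum_rank) /=; last first.
  exact/onW_bij/enum_rank_bij.
by apply: eq_bigr => -[i j] _; rewrite EE enum_rankK.
Qed.

Lemma Hn_ext (W : lmodType k) (f g : {linear A -> W}) :
  (forall (i : 'I_N) (j : 'I_n), f (x ^+ i * y ^+ j) = g (x ^+ i * y ^+ j)) ->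
  f =1 g.
Proof.
move=> fg z; have [c ->] := Hn_span z; rewrite !linear_sum; apply: eq_bigr => i _.
by rewrite !linear_sum; apply: eq_bigr => j _; rewrite !linearZ /= fg.
Qed.

(** Only spanning is known, so the coefficients of [u] are not yet unique; the proof shows that any
    choice of them vanishes. This gives injectivity without first proving the monomials
    independent. *)
Lemma Hn_nondegenerate (V : Type) (w : 'I_N -> 'I_n -> V) (d : 'I_N -> k)
    (B : V -> {linear A -> k^o}) u :
    n.-primitive_root zeta -> (forall i, d i != 0) ->
    (forall (i l : 'I_N) (j r : 'I_n), B (w l r) (x ^+ i * y ^+ j)
       = (i == l)%:R * d i * zeta ^+ (j * r)) ->
  (forall v, B v u = 0) -> u = 0.
Proof.
move=> zeta_prim d0 Bw B0; have [c uE] := Hn_span u.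
rewrite uE big1 // => i _; rewrite big1 // => j0 _.
suff -> : c i j0 = 0 by rewrite scale0r.
(* For fixed [i], pairing [u] with [w i r] gives d_i p(zeta^r), so [p], of size at most [n], has [n]
   distinct roots. *)
pose p := \sum_j c i j *: 'X^j.
suff p0 : p = 0.
  have := congr1 (coefp j0) p0; rewrite /= coef0 coef_sum (bigD1 j0) //=.
  rewrite coefZ coefXn eqxx mulr1 big1 ?addr0 // => j jj0.
  by rewrite coefZ coefXn eq_sym (inj_eq val_inj) (negPf jj0) mulr0.
apply: (@roots_geq_poly_eq0 _ p [seq zeta ^+ r | r : 'I_n]).
- apply/allP => _ /mapP[r _ ->]; apply/rootP.
  have := B0 (w i r); rewrite uE linear_sum /=.
  rewrite (bigD1 i) //= [X in _ + X]big1 ?addr0 => [|l /negPf li]; last first.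
    by rewrite linear_sum big1 // => j _; rewrite linearZ /= Bw li !mul0r scaler0.
  move=> e; apply: (mulfI (d0 i)); rewrite mulr0 -[RHS]e horner_sum mulr_sumr linear_sum.
  apply: eq_bigr => j _; rewrite hornerZ hornerXn linearZ /= Bw eqxx mul1r mulrCA.
  by rewrite mulnC exprM.
- rewrite map_inj_uniq ?enum_uniq // => r s /eqP.
  rewrite (eq_prim_root_expr zeta_prim) !modn_small // => /eqP.
  exact: val_inj.
rewrite size_map size_enum_ord; apply: leq_trans (size_sum _ _ _) _.
apply/bigmax_leqP => j _; apply: leq_trans (size_scale_leq _ _) _.
by rewrite size_polyXn.
Qed.

End Monomials.

(** * Vanishing and nonvanishing of q-factorials at a root of unity *)

Section QFactorial.
Variables (k : fieldType) (N : nat) (q : k).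
Hypothesis q_prim : N.-primitive_root q.

Lemma qintS i : qint q i.+1 = 1 + q * qint q i.
Proof.
rewrite /qint big_ord_recl expr0 mulr_sumr; congr (1 + _).
by apply: eq_bigr => j _; rewrite -exprS.
Qed.

Lemma qfactS i : qfact q i.+1 = qfact q i * qint q i.+1.
Proof. by rewrite /qfact big_nat_recr. Qed.

Lemma qfact_neq0 i : (i < N)%N -> qfact q i != 0.
Proof.
elim: i => [|i IH] ltiN; first by rewrite /qfact big_geq ?oner_neq0.
rewrite qfactS mulf_neq0 ?IH 1?ltnW //; apply: contraTneq ltiN => q0.
(* Since (q - 1)(i+1)_q = q^(i+1) - 1, a zero of (i+1)_q would make the order [N] divide i + 1 <
   N. *)
have := subrX1 q i.+1; rewrite -/(qint q i.+1) q0 mulr0 => /eqP.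
by rewrite subr_eq0 -(prim_order_dvd q_prim) -leqNgt; apply: dvdn_leq.
Qed.

Lemma qfact_order : q != 1 -> qfact q N = 0.
Proof.
move=> q1; have := prim_order_gt0 q_prim; case: N q_prim => // M qM _.
rewrite qfactS; apply/eqP; rewrite mulf_eq0; apply/orP; right.
have := subrX1 q M.+1; rewrite (prim_expr_order qM) subrr => /esym/eqP.
by rewrite mulf_eq0 subr_eq0 (negPf q1).
Qed.

End QFactorial.

(** * Tensor products of algebras and of algebra maps *)

Section TensorProducts.
Variables (k : fieldType) (A B : falgType k).

Lemma tensM (a c : A) (b d : B) :
  (a \ox b : tensor A B) * (c \ox d : tensor A B) = (a * c) \ox (b * d).
Proof. exact: tmulE. Qed.

Lemma tensX (a : A) (b : B) i :
  (a \ox b : tensor A B) ^+ i = (a ^+ i) \ox (b ^+ i).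
Proof.
elim: i => [|i IH]; first by rewrite !expr0.
by rewrite exprS IH tensM -!exprS.
Qed.

End TensorProducts.

Section TensorMap.
Variables (k : fieldType) (A B C : falgType k) (f : {lrmorphism A -> C}).

(** This is f (x) id. *)
Definition tmapl : tensor A B -> tensor C B := tlift (fun a b => f a \ox b).

HB.instance Definition _ := GRing.Linear.on tmapl.

Lemma tens_mapl_bilinear :
  bilinear_for *:%R *:%R (fun a b => f a \ox b : tensor C B).
Proof.
by split=> [b|a] e u v; rewrite ?linearP /= ?linearPl ?linearPr.
Qed.

Lemma tmaplE a b : tmapl (a \ox b) = f a \ox b.
Proof. exact: tliftE tens_mapl_bilinear _ _. Qed.

Lemma tmapl_monoid : monoid_morphism tmapl.
Proof.
split; first by rewrite [LHS]tmaplE rmorph1.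
move=> z w; move: z; apply: tens_ext => [e u v|e u v|a b].
- by rewrite mulrDl -scalerAl linearP.
- by rewrite linearP mulrDl -scalerAl.
move: w; apply: tens_ext => [e u v|e u v|c d].
- by rewrite mulrDr -scalerAr linearP.
- by rewrite linearP mulrDr -scalerAr.
by rewrite /= tensM !tmaplE tensM rmorphM.
Qed.

HB.instance Definition _ := GRing.isMonoidMorphism.Build _ _ tmapl tmapl_monoid.

End TensorMap.

Section PushDual.
Variables (k : fieldType) (K : hopfAlgType k) (C : falgType k).
Variables (f : {lrmorphism K -> C}) (mu : {linear C -> k^o}) (phi : hdual K).

Definition contract : tensor C K -> k^o :=
  tlift (fun c z => mu c * dapp phi z : k^o).

HB.instance Definition _ := GRing.Linear.on contract.

Lemma contractE c z : contract (c \ox z) = mu c * dapp phi z.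
Proof.
apply: tliftE; split=> [v|v] e u w;
  by rewrite linearP /= ?mulrDl ?mulrDr -?scalerAl -?scalerAr.
Qed.

(** As f (x) id and [comul] are algebra maps, convolving with mu o f on a monomial reduces to
    computing powers in C (x) K. *)
Lemma dapp_pull_mul z :
  dapp (functional (mu \o f) * phi) z = contract (tmapl f (comul z)).
Proof.
rewrite dapp_mul [RHS](tlift_comp contract); apply: eq_tlift => a b.
by rewrite /= contractE functionalE.
Qed.

End PushDual.

(** * The upper triangular 2 x 2 matrices used by the skew representation *)

Section Upper2.
Variable k : fieldType.

Definition E12 : 'M[k]_2 := delta_mx ord0 ord_max.

Definition diag1 (c : k) : 'M[k]_2 :=
  c *: delta_mx ord0 ord0 + delta_mx ord_max ord_max.

Definition entry12 (M : 'M[k]_2) : k^o := M ord0 ord_max.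

Lemma entry12_linear : linear entry12.
Proof. by move=> c M M'; rewrite /entry12 !mxE. Qed.

HB.instance Definition _ := GRing.isLinear.Build k 'M[k]_2 k^o *:%R
  entry12 entry12_linear.

Lemma diag1_1 : diag1 1 = 1.
Proof.
rewrite /diag1 scale1r [RHS]mx1_sum_delta big_ord_recl big_ord1.
by rewrite (_ : lift _ _ = ord_max) //; apply: val_inj.
Qed.

Lemma diag1M c d : diag1 c * diag1 d = diag1 (c * d).
Proof.
rewrite /diag1 mulrDl !mulrDr -!scalerAl -!scalerAr -!mulmxE !mul_delta_mx_cond.
by rewrite /= !mulr1n !mulr0n !scaler0 addr0 add0r scalerA.
Qed.

Lemma diag1X c i : diag1 c ^+ i = diag1 (c ^+ i).
Proof.
elim: i => [|i IH]; first by rewrite !expr0 diag1_1.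
by rewrite !exprS IH diag1M.
Qed.

Lemma diag1_E12 c : diag1 c * E12 = c *: E12.
Proof.
rewrite mulrDl -scalerAl -!mulmxE !mul_delta_mx_cond /=.
by rewrite mulr1n mulr0n addr0.
Qed.

Lemma E12_diag1 c : E12 * diag1 c = E12.
Proof.
rewrite mulrDr -scalerAr -!mulmxE !mul_delta_mx_cond /=.
by rewrite mulr1n mulr0n scaler0 add0r.
Qed.

Lemma E12_sqr : E12 * E12 = 0.
Proof. by rewrite -mulmxE mul_delta_mx_cond. Qed.

Lemma entry12_diag1 c : entry12 (diag1 c) = 0.
Proof. by rewrite /entry12 !mxE /= mulr0 addr0. Qed.

Lemma entry12_E12 : entry12 E12 = 1.
Proof. by rewrite /entry12 mxE. Qed.

End Upper2.

(** * Generators of the dual, their values on monomials and their relations *)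

Section DualGenerators.
Variables (k : fieldType) (n N m t : nat) (zeta : k).
Variables (K : hopfAlgType k) (y x : K).
Hypothesis K_def : is_Hn n N zeta m t y x.
Let q := zeta ^+ (m * t).

Lemma counit_monomial i j : counit (x ^+ i * y ^+ j) = (i == 0)%:R.
Proof.
rewrite rmorphM !rmorphXn /= (Hn_counit_x K_def) (Hn_counit_y K_def).
by rewrite expr1n mulr1 expr0n.
Qed.

Section Char.
Variable chi : {lrmorphism K -> k^o}.
Hypotheses (chi_y : chi y = zeta) (chi_x : chi x = 0).

(** [chi] kills the summand x (x) 1, so chi (x) id sends [comul x] to zeta^m (x) x and [comul y] to
    zeta (x) y. *)
Lemma dual_char_mul (phi : hdual K) i j :
  dapp (functional chi * phi) (x ^+ i * y ^+ j)
  = zeta ^+ (m * i + j) * dapp phi (x ^+ i * y ^+ j).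
Proof.
have -> : functional chi = functional (idfun \o chi) by [].
rewrite dapp_pull_mul !rmorphM !rmorphXn /= (Hn_comul_x K_def) (Hn_comul_y K_def).
rewrite !linearD /= !tmaplE chi_x chi_y linear0l addr0 !tensX tensM contractE.
by rewrite /= rmorphXn /= chi_y -exprM -exprD.
Qed.

End Char.

Section Skew.
Variable rho : {lrmorphism K -> 'M[k]_2}.
Hypotheses (rho_y : rho y = diag1 (zeta ^+ t)) (rho_x : rho x = E12 k).

(* rho (x) id turns comul into a map K -> M_2 (x) K whose (1,2) entry is the
   skew derivation z |-> a(z_(1)) z_(2); the powers of the image of x have only
   two terms because E12 squares to 0. *)
Lemma tmapl_comul_xX i :
  tmapl rho (comul x) ^+ i = diag1 (q ^+ i) \ox (x ^+ i)
    + qint q i *: (E12 k \ox (x ^+ i.-1)).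
Proof.
have Tx : tmapl rho (comul x) = (diag1 q \ox x + E12 k \ox 1).
  rewrite (Hn_comul_x K_def) linearD /= !tmaplE rmorphXn /= rho_y rho_x.
  by rewrite diag1X -exprM mulnC.
elim: i => [|i IH].
  by rewrite !expr0 /qint big_ord0 scale0r addr0 diag1_1.
rewrite exprS IH Tx mulrDl !mulrDr -!scalerAr !tensM diag1M -!exprS.
rewrite E12_diag1 E12_sqr diag1_E12 (mul1r (x ^+ i)) linear0l scaler0 addr0 -addrA.
congr (_ + _); rewrite qintS scalerDl scale1r addrC linearZl_LR /= scalerA.
(* At i = 0 the truncated [i.-1] breaks x x^(i-1) = x^i, but there the coefficient (0)_q is zero. *)
case: i {IH} => [|i] /=; last by rewrite mulrC.
by rewrite /qint big_ord0 !(mul0r, mulr0) !scale0r.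
Qed.

(** Only the [E12] summand has a (1,2) entry, and it absorbs the diagonal image of [y] on its right,
    so [y] contributes no scalar. *)
Lemma dual_skew_mul (phi : hdual K) i j :
  dapp (functional (@entry12 k \o rho) * phi) (x ^+ i * y ^+ j)
  = qint q i * dapp phi (x ^+ i.-1 * y ^+ j).
Proof.
rewrite dapp_pull_mul !rmorphM !rmorphXn /= tmapl_comul_xX (Hn_comul_y K_def).
rewrite tmaplE rho_y tensX diag1X mulrDl -scalerAl !tensM diag1M E12_diag1.
rewrite linearD linearZ /= !contractE /= entry12_diag1 entry12_E12.
by rewrite mul0r add0r mul1r.
Qed.

End Skew.

Lemma dual_generators : (0 < n)%N -> n.-primitive_root zeta -> q != 1 ->
  exists b a : hdual K, Hn_rel n N zeta m b a /\
    forall i j l r, dapp (a ^+ i * b ^+ j) (x ^+ l * y ^+ r)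
      = (i == l)%:R * qfact q i * zeta ^+ (j * r).
Proof.
move=> n_gt0 zeta_prim q1; have q_prim := Hn_ord K_def.
have zn := prim_expr_order zeta_prim.
(* 1 < N lets [E12], whose square is 0, satisfy the relation x^N = 0. *)
have [N0 N1] : (0 < N)%N /\ (1 < N)%N.
  have N0 := prim_order_gt0 q_prim; split=> //; rewrite ltn_neqAle N0 andbT.
  by apply: contra q1 => /eqP N1; rewrite -(expr1 q) N1 prim_expr_order.
have [chi [chi_y chi_x]] : exists chi : {lrmorphism K -> k^o},
    chi y = zeta /\ chi x = 0.
  apply: (Hn_univ K_def); split; rewrite ?mulr0 ?mul0r ?scaler0 //.
  by rewrite expr0n eqn0Ngt N0.
have [rho [rho_y rho_x]] : exists rho : {lrmorphism K -> 'M[k]_2},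
    rho y = diag1 (zeta ^+ t) /\ rho x = E12 k.
  apply: (Hn_univ K_def); split.
  - by rewrite diag1X exprAC zn expr1n diag1_1.
  - by rewrite -(subnK N1) exprD expr2 E12_sqr mulr0.
  by rewrite diag1_E12 E12_diag1.
set b := functional chi; set a := functional (@entry12 k \o rho).
have bM := dual_char_mul chi_y chi_x; rewrite -/b in bM.
have aM := dual_skew_mul rho_y rho_x; rewrite -/a in aM.
have bX j l r : dapp (b ^+ j) (x ^+ l * y ^+ r) = (l == 0)%:R * zeta ^+ (j * r).
  elim: j => [|j IH].
    by rewrite expr0 dapp_one counit_monomial mulr1.
  rewrite exprS bM IH mulrCA -exprD; case: eqP => [->|_]; last by rewrite !mul0r.
  by rewrite muln0 add0n mulSn.
(* This holds for all natural exponents: for l >= N the left side has x^l = 0, and on the right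
   (l)_q! contains the factor (N)_q = 0. *)
have vals i j l r : dapp (a ^+ i * b ^+ j) (x ^+ l * y ^+ r)
    = (i == l)%:R * qfact q i * zeta ^+ (j * r).
  elim: i l => [|i IH] l.
    by rewrite expr0 mul1r bX eq_sym /qfact big_geq ?mulr1.
  rewrite exprS -mulrA aM IH; case: l => [|l] /=.
    by rewrite /qint big_ord0 !mul0r.
  rewrite eqSS qfactS; case: eqP => [->|_]; last by rewrite !mul0r mulr0.
  by rewrite !mul1r mulrCA mulrA.
have ext (f g : hdual K) : (forall l r,
    dapp f (x ^+ l * y ^+ r) = dapp g (x ^+ l * y ^+ r)) -> f = g.
  move=> fg; apply: dapp_inj.
  apply: (Hn_ext (f := dapp f) (g := dapp g) n_gt0 (Hn_gen K_def) (Hn_relP K_def)).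
  by move=> l r; exact: fg.
exists b, a; split=> //; split; apply: ext => l r.
- rewrite bX dapp_one counit_monomial exprM zn expr1n mulr1 //.
- have := vals N 0%N l r; rewrite expr0 mulr1 qfact_order // => ->.
  by rewrite mulr0 mul0r dapp0.
(* For the commutation relation only l = 1 contributes; there left multiplication by [b] gives the
   factor zeta^(m + r). *)
have := vals 1%N 1%N l r; rewrite dappZ !expr1 bM => ->.
have := vals 1%N 0%N l r; rewrite expr0 mulr1 expr1 => ->.
rewrite mulrCA; case: eqP => [<-|_]; last by rewrite !mul0r mulr0.
by rewrite muln1 mul0n expr0 mulr1 mul1n exprD mulrCA.
Qed.

End DualGenerators.

(** * Compatibility of a pairing with the antipodes *)

Lemma tlift_exchange (k : fieldType) (U V U' V' : vectType k) (W : lmodType k)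
    (F : U -> V -> U' -> V' -> W) z w :
  tlift (fun a b => tlift (F a b) w) z
  = tlift (fun c d => tlift (fun a b => F a b c d) z) w.
Proof.
have tlift_pairs (X Y : vectType k) (f : X -> Y -> W) v : tlift f v =
    \sum_p (v : 'M_(_, _)) p.1 p.2 *: f (cbase p.1) (cbase p.2).
  by rewrite /tlift pair_bigA.
rewrite !tlift_pairs; under eq_bigr do rewrite tlift_pairs scaler_sumr.
under [RHS]eq_bigr do rewrite tlift_pairs scaler_sumr.
rewrite exchange_big; apply: eq_bigr => p _; apply: eq_bigr => r _.
by rewrite !scalerA mulrC.
Qed.

Section PairingAntipode.
Variables (k : fieldType) (H K : hopfAlgType k).
Variable f : {lrmorphism H -> hdual K}.
Hypothesis f_mulr : forall u z w, dapp (f u) (z * w)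
  = tlift (fun a b => dapp (f a) z * dapp (f b) w : k^o) (comul u).
Hypothesis f_1r : forall u, dapp (f u) 1 = counit u.

Let twist u : hdual K := functional (dapp (f u) \o antipode).

Let twist_linear : linear twist.
Proof.
move=> c u v; apply/dapp_inj => z.
by rewrite dappPl !functionalE /= linearP dappPl.
Qed.

HB.instance Definition _ := GRing.isLinear.Build k H (hdual K) *:%R
  twist twist_linear.

(* In Hom(H, K^* ), u |-> f (S u) is a left and [twist] a right convolution
   inverse of f, hence they agree. *)
Lemma pairing_antipode u z :
  dapp (f (antipode u)) z = dapp (f u) (antipode z).
Proof.
have fSf v : conv (f \o antipode) f v = counit v *: 1.
  transitivity (f (counit v *: 1)); last by rewrite linearZ /= rmorph1.
  rewrite -antipodel tlift_comp; apply: eq_tlift => a b.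
  by rewrite rmorphM.
have fft v : conv f twist v = counit v *: 1.
  apply/dapp_inj => w; rewrite dappZ dapp_one -[LHS]/(deval w _) convE tlift_comp.
  (* The product in [hdual K] splits [w] into c and d; [f_mulr] then recombines the two halves of
     [v], leaving c S(d) to collapse. *)
  transitivity (tlift (fun c d => dapp (f v) (c * antipode d)) (comul w)).
    under eq_tlift => a b do rewrite /= /deval dapp_mul.
    rewrite tlift_exchange; apply: eq_tlift => c d; rewrite f_mulr.
    by apply: eq_tlift => a b; rewrite functionalE.
  by rewrite -(tlift_comp (dapp (f v))) antipoder linearZ /= f_1r mulrC.
suff -> : f (antipode u) = twist u by rewrite functionalE.
transitivity (conv (f \o antipode) (conv f twist) u).
  rewrite -[in LHS](counitr u) -[LHS]/((f \o antipode) _) tlift_comp convE.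
  by apply: eq_tlift => a b; rewrite linearZ /= fft -scalerAr mulr1.
rewrite convA -[in RHS](counitl u) tlift_comp convE.
by apply: eq_tlift => a b; rewrite linearZ /= fSf -scalerAl mul1r.
Qed.

End PairingAntipode.

(** * Embeddings into the duals, and the form built from them *)

Lemma Hn_dual_embedding (k : fieldType) (n N m t : nat) (zeta : k)
    (H K : hopfAlgType k) (Y X : H) (y x : K) :
    (0 < n)%N -> n.-primitive_root zeta -> zeta ^+ (m * t) != 1 ->
    is_Hn n N zeta t m Y X -> is_Hn n N zeta m t y x ->
  exists2 f : {lrmorphism H -> hdual K}, injective f
    & forall i j l r, dapp (f (X ^+ i * Y ^+ j)) (x ^+ l * y ^+ r)
      = (i == l)%:R * qfact (zeta ^+ (m * t)) i * zeta ^+ (j * r).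
Proof.
move=> n_gt0 zeta_prim q1 H_def K_def.
have [b [a [ba_rel vals]]] := dual_generators K_def n_gt0 zeta_prim q1.
have [f [fY fX]] := Hn_univ H_def ba_rel.
have fE i j l r : dapp (f (X ^+ i * Y ^+ j)) (x ^+ l * y ^+ r)
    = (i == l)%:R * qfact (zeta ^+ (m * t)) i * zeta ^+ (j * r).
  by rewrite rmorphM !rmorphXn /= fX fY vals.
exists f => // u v fuv; apply/eqP; rewrite -subr_eq0; apply/eqP.
(* The test functionals are evaluations at monomials of [K], with weights (i)_q!, nonzero for i <
   N. *)
apply: (Hn_nondegenerate n_gt0 (Hn_gen H_def) (Hn_relP H_def) zeta_prim
  (w := fun l r => x ^+ l * y ^+ r) (B := fun z => deval z \o f)
  (d := fun i => qfact (zeta ^+ (m * t)) i)).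
- by move=> i; apply: qfact_neq0 (Hn_ord K_def) _ _.
- by move=> i l j r; rewrite /= /deval fE.
by move=> z; rewrite linearB /= fuv subrr.
Qed.

Theorem proposition4p10 (k : closedFieldType) (k_char0 : [pchar k] =i pred0)
    (n m t : nat) (n_gt0 : (0 < n)%N) (m_dvd : (m %| n)%N) (t_dvd : (t %| n)%N)
    (n_ndvd : ~~ (n %| m * t)%N)
    (zeta : k) (zeta_prim : n.-primitive_root zeta)
    (N : nat) (N_ord : N.-primitive_root (zeta ^+ (m * t)))
    (H : hopfAlgType k) (Y X : H) (H_def : is_Hn n N zeta t m Y X)
    (K : hopfAlgType k) (y x : K) (K_def : is_Hn n N zeta m t y x) :
  let q := zeta ^+ (m * t) in
  let basis_values (B : {bilinear H -> K -> k^o}) :=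
    forall (i l : 'I_N) (j r : 'I_n),
      B (X ^+ i * Y ^+ j) (x ^+ l * y ^+ r)
      = (i == l)%:R * qfact q i * zeta ^+ (j * r) in
  exists B : {bilinear H -> K -> k^o},
    [/\ basis_values B,
        forall B' : {bilinear H -> K -> k^o}, basis_values B' ->
          forall u z, B' u z = B u z
      & perfect_duality B].
Proof.
move=> q basis_values.
(* This is where n not dividing mt enters. *)
have q1 : zeta ^+ (m * t) != 1 by rewrite -(prim_order_dvd zeta_prim).
have [f f_inj fE] := Hn_dual_embedding n_gt0 zeta_prim q1 H_def K_def.
have [g g_inj gE] : exists2 g : {lrmorphism K -> hdual H}, injective g
    & forall i j l r, dapp (g (x ^+ i * y ^+ j)) (X ^+ l * Y ^+ r)
      = (i == l)%:R * qfact (zeta ^+ (t * m)) i * zeta ^+ (j * r).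
  by apply: Hn_dual_embedding n_gt0 zeta_prim _ K_def H_def; rewrite mulnC.
pose Hext W := Hn_ext (W := W) n_gt0 (Hn_gen H_def) (Hn_relP H_def).
pose Kext W := Hn_ext (W := W) n_gt0 (Hn_gen K_def) (Hn_relP K_def).
(* The values on monomials are symmetric under exchanging (i, j) with (l, r), so the two forms
   agree. Multiplicativity in [K], the unit rule at 1 in [K] and nondegeneracy on [K] are all
   carried over from [g] through this equality. *)
have fg u z : dapp (f u) z = dapp (g z) u.
  apply: (Hext _ (deval z \o f) (dapp (g z))) => i j /=.
  apply: (Kext _ (dapp (f _)) (deval _ \o g)) => l r /=.
  rewrite /deval fE gE eq_sym [(t * m)%N]mulnC [(j * r)%N]mulnC.
  by case: eqP => [->|_] //; rewrite !mul0r.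
pose B0 u z := dapp (f u) z.
have B0_bil : bilinear_for *:%R *:%R (B0 : H -> K -> k^o).
  by split=> [z|u] c v w; rewrite /B0 /= linearP // dappPl.
pose B : {bilinear H -> K -> k^o} := HB.pack B0
  (bilinear_isBilinear.Build k H K k^o *:%R *:%R B0 B0_bil).
have BE u z : B u z = dapp (f u) z by [].
have Bmulr u z w : dapp (f u) (z * w)
    = tlift (fun a b => dapp (f a) z * dapp (f b) w : k^o) (comul u).
  rewrite fg rmorphM dapp_mul; apply: eq_tlift => a b.
  by rewrite !fg.
have B1r u : dapp (f u) 1 = counit u by rewrite fg rmorph1 dapp_one.
exists B; split.
- by move=> i l j r; rewrite BE fE.
- move=> B' B'E u z; rewrite BE.
  apply: (Hext _ (applyr B' z) (deval z \o f)) => i j /=.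
  apply: (Kext _ (B' _) (dapp (f _))) => l r /=.
  by rewrite B'E fE.
split; first split.
- by move=> u v z; rewrite BE rmorphM dapp_mul.
- by move=> u z w; rewrite BE Bmulr.
- by move=> z; rewrite BE rmorph1 dapp_one.
- by move=> u; rewrite BE B1r.
- by move=> u z; rewrite !BE pairing_antipode.
- by move=> u v uv; apply/f_inj/dapp_inj.
by move=> z w zw; apply/g_inj/dapp_inj => u; rewrite -!fg; apply: zw.
Qed.
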